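(* Let $\alpha\in[0,1)$ and let $G$ be a connected graph of order $n\ge 2$ with maximum degree $\Delta$ and second maximum degree $\Delta'$. Then \[ \mu_{\alpha}(G)\ \ge\ \frac{1}{2}\left(\alpha(4n-4-\Delta-\Delta')+\sqrt{\alpha^2(4n-4-\Delta-\Delta')^2-4(2\alpha-1)(2n-2-\Delta)(2n-2-\Delta')}\right), \] with equality if and only if $G$ is regular with diameter at most $2$.
   Context: All graphs are finite, simple and undirected; $d_G(u,v)$ is the distance between $u$ and $v$ in the connected graph $G$. If $(d_1,\dots,d_n)$ is the nonincreasing degree sequence of $G$ (order $n\ge2$), then the maximum degree is $d_1$ and the second maximum degree is $d_2$ (so they may coincide). The diameter of $G$ is the maximum distance between pairs of vertices. The transmission of a vertex $u$ is $T_G(u)=\sum_{v\in V(G)}d_G(u,v)$. Let $T(G)$ be the diagonal matrix of transmissions and $D(G)=(d_G(u,v))_{u,v\in V(G)}$ the distance matrix. For $\alpha\in[0,1)$, $D_{\alpha}(G)=\alpha T(G)+(1-\alpha)D(G)$, and $\mu_{\alpha}(G)$ (the distance $\alpha$-spectral radius) is the largest eigenvalue of the symmetric matrix $D_{\alpha}(G)$. *)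

(* Defs.v *)
From HB Require Import structures.
From mathcomp Require Import all_boot all_order all_algebra.
From mathcomp Require Import boolp classical_sets reals.

Set Implicit Arguments.
Unset Strict Implicit.
Unset Printing Implicit Defensive.

Import Order.TTheory GRing.Theory Num.Theory.

Local Open Scope ring_scope.

(* A simple undirected graph on V is a symmetric irreflexive e : rel V. *)

Definition is_connected (V : finType) (e : rel V) : Prop :=
  forall u v : V, connect e u v.

Section Graph.
Variables (V : finType) (e : rel V).

Definition walk_of_length (u v : V) (k : nat) : bool :=
  [exists p : k.-tuple V, path e u p && (last u p == v)].

(* A shortest path has fewer than #|V| edges, so the search range is large
   enough; the value is #|V| when u and v are not connected. *)
Definition dist (u v : V) : nat :=
  find (walk_of_length u v) (iota 0 #|V|).

Lemma dist_walk (u v : V) : connect e u v ->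
  exists p : seq V, [/\ path e u p, last u p = v & size p = dist u v].
Proof.
move=> /connectP[q e_q ->]; case/shortenP: e_q => p e_p Up _.
have ltp : (size p < #|V|)%N.
  by have := max_card (mem (u :: p)); rewrite (card_uniqP Up).
have hw : has (walk_of_length u (last u p)) (iota 0 #|V|).
  apply/hasP; exists (size p); first by rewrite mem_iota.
  apply/existsP; exists (in_tuple p).
  by rewrite e_p /= eqxx.
have := nth_find 0%N hw.
rewrite nth_iota ?add0n; last by move: hw; rewrite has_find size_iota.
by case/existsP=> t /andP[et /eqP lt]; exists t; rewrite size_tuple.
Qed.

Lemma dist_min (u : V) (p : seq V) :
  path e u p -> (dist u (last u p) <= size p)%N.
Proof.
move=> ep; have [ltp|] := ltnP (size p) #|V|; last first.
  by apply: leq_trans; rewrite -[leqRHS](size_iota 0) find_size.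
rewrite leqNgt; apply/negP => /(before_find 0%N).
rewrite nth_iota // add0n => /negbT/existsP; apply.
by exists (in_tuple p); rewrite ep eqxx.
Qed.

Definition degree (u : V) : nat := #|[set v | e u v]|.

Definition degree_sequence : seq nat :=
  sort geq [seq degree u | u <- enum V].

Definition max_degree : nat := nth 0%N degree_sequence 0.

Definition second_max_degree : nat := nth 0%N degree_sequence 1.

Definition regular : Prop := exists k : nat, forall u : V, degree u = k.

Definition diameter : nat := \max_(u : V) \max_(v : V) dist u v.

Definition transmission (u : V) : nat := (\sum_(v : V) dist u v)%N.

End Graph.

(* Rows and columns are indexed by 'I_#|V| through the bijection enum_val. *)

Definition transmission_matrix (R : realType) (V : finType) (e : rel V) :
    'M[R]_#|V| :=
  diag_mx (\row_i (transmission e (enum_val i))%:R).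

Definition distance_matrix (R : realType) (V : finType) (e : rel V) :
    'M[R]_#|V| :=
  \matrix_(i, j) (dist e (enum_val i) (enum_val j))%:R.

Definition distance_alpha_matrix (R : realType) (V : finType) (e : rel V)
    (alpha : R) : 'M[R]_#|V| :=
  alpha *: transmission_matrix R e + (1 - alpha) *: distance_matrix R e.

Definition eigenvalue_set (R : realType) (n : nat) (A : 'M[R]_n) : set R :=
  [set a | eigenvalue A a]%classic.

(* The default value 0 is only used when A has no largest eigenvalue. *)
Definition largest_eigenvalue (R : realType) (n : nat) (A : 'M[R]_n) : R :=
  xget 0 (eigenvalue_set A `&` ubound (eigenvalue_set A))%classic.

Definition distance_alpha_spectral_radius (R : realType) (V : finType)
    (e : rel V) (alpha : R) : R :=
  largest_eigenvalue (distance_alpha_matrix e alpha).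

(* Main.v *)
Require Import Defs.
From HB Require Import structures.
From mathcomp Require Import all_boot all_order all_algebra.
From mathcomp Require Import boolp classical_sets reals.
From mathcomp Require Import ring lra.

Set Implicit Arguments.
Unset Strict Implicit.
Unset Printing Implicit Defensive.

Import Order.TTheory GRing.Theory Num.Theory.

Local Open Scope ring_scope.

(* Every vertex satisfies T(v) >= 2n - 2 - deg v, with equality iff all its
   distances are at most 2. Put t1 = 2n - 2 - Delta <= t2 = 2n - 2 - Delta'. The
   bound lam is the larger root of
     (lam - alpha t1) (lam - alpha t2) = (1 - alpha)^2 t1 t2,
   i.e. the spectral radius of the 2 x 2 matrix with rows
   (alpha t1, (1 - alpha) t1) and ((1 - alpha) t2, alpha t2). Let (x1, x2) be its
   positive eigenvector; t1 <= t2 gives x1 <= x2. The vector x equal to x1 at a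
   vertex of maximum degree and to x2 elsewhere satisfies D_alpha x >= lam x
   entrywise, so its Rayleigh quotient is at least lam. If mu = lam then
   D_alpha x = lam x, which forces t1 = t2 and all transmissions equal to t1. *)

(** * Rayleigh quotients and the largest eigenvalue of a real matrix *)

Section RayleighQuotient.
Variables (R : realType) (n : nat).
Implicit Types (A B : 'M[R]_n) (x y : 'rV[R]_n).

Definition quad A x : R := (x *m A *m x^T) 0 0.

Lemma quadE A x : quad A x = \sum_j (x *m A) 0 j * x 0 j.
Proof. by rewrite /quad mxE; apply: eq_bigr => j _; rewrite [x^T _ _]mxE. Qed.

Lemma quad1E x : quad 1%:M x = \sum_j x 0 j ^+ 2.
Proof. by rewrite quadE mulmx1; apply: eq_bigr => j _; rewrite expr2. Qed.

Lemma quad1_ge0 x : 0 <= quad 1%:M x.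
Proof. by rewrite quad1E sumr_ge0 // => j _; rewrite sqr_ge0. Qed.

Lemma quad1_gt0 x : x != 0 -> 0 < quad 1%:M x.
Proof.
move=> x0; rewrite lt_neqAle quad1_ge0 andbT eq_sym; apply: contra x0.
rewrite quad1E psumr_eq0 => [/allP xz|j _]; last exact: sqr_ge0.
apply/eqP/rowP => j; rewrite mxE; apply/eqP.
by have := xz j (mem_index_enum j); rewrite sqrf_eq0.
Qed.

Lemma quad_scalar_sub A x m :
  quad (m%:M - A) x = m * quad 1%:M x - quad A x.
Proof.
by rewrite /quad mulmxBr mulmxBl mul_mx_scalar -scalemxAl mulmx1 !mxE.
Qed.

(** The sum of the absolute values of the entries serves as [C]; adding 1 makes it positive even for
    the zero matrix. This bounds the Rayleigh quotients of [A], and is also applied to an inverse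
    matrix. *)
Lemma quad_le A : exists2 C, 0 < C & forall x, quad A x <= C * quad 1%:M x.
Proof.
exists (1 + \sum_j \sum_i `|A i j|).
  by apply: ltr_wpDr => //; do 2!apply: sumr_ge0 => ? _.
move=> x; rewrite mulrDl mul1r; apply: ler_wpDl; first exact: quad1_ge0.
rewrite quadE mulr_suml; apply: ler_sum => j _.
rewrite mxE !mulr_suml; apply: ler_sum => i _.
have sq k : x 0 k ^+ 2 <= quad 1%:M x.
  by rewrite quad1E (bigD1 k) //= lerDl sumr_ge0 // => l _; rewrite sqr_ge0.
rewrite (le_trans (ler_norm _)) // !normrM mulrAC mulrC ler_wpM2l //.
(* The square of [|x i| - |x j|] gives [|x i| * |x j|] at most the mean of the two squares, each of
   which is at most [quad 1%:M x]. *)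
have := sq i; have := sq j; rewrite -(real_normK (num_real (x 0 i))).
rewrite -(real_normK (num_real (x 0 j))).
by have := sqr_ge0 (`|x 0 i| - `|x 0 j|); nra.
Qed.

(* With y = x B^-1, positivity at x - y/C reads
   x B x^T - 2 |x|^2 / C + (x B^-1 x^T) / C^2 >= 0. *)
Lemma psd_unit_coercive B : B^T = B -> B \in unitmx ->
  (forall x, 0 <= quad B x) ->
  exists2 c, 0 < c & forall x, c * quad 1%:M x <= quad B x.
Proof.
move=> Bsym Bu Bpsd; have [C C0 Cle] := quad_le (invmx B).
exists C^-1; first by rewrite invr_gt0.
move=> x; have := Bpsd (x - C^-1 *: (x *m invmx B)).
have -> : quad B (x - C^-1 *: (x *m invmx B)) =
   quad B x - 2 * C^-1 * quad 1%:M x + C^-1 ^+ 2 * quad (invmx B) x.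
  rewrite /quad raddfB /= !mulmxBl !mulmxBr -!scalemxAl mulmxKV // linearZ /=.
  rewrite -!scalemxAr trmx_mul trmx_inv Bsym !mulmxA mulmxK // mulmx1 !mxE.
  by ring.
have /(ler_wpM2l (sqr_ge0 C^-1)) := Cle x.
have -> : C^-1 ^+ 2 * (C * quad 1%:M x) = C^-1 * quad 1%:M x.
  by rewrite mulrA expr2 mulfVK // gt_eqF.
by lra.
Qed.

(** A greatest eigenvalue is unique by antisymmetry, and the default of [xget] is excluded because
    [m] itself qualifies. *)
Lemma largest_eigenvalue_eq A m : eigenvalue A m ->
  (forall a, eigenvalue A a -> a <= m) -> largest_eigenvalue A = m.
Proof.
move=> Am mub; rewrite /largest_eigenvalue; case: xgetP => [b _ [Ab bub]|/(_ m) []].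
  by apply/eqP; rewrite eq_le mub // bub.
by split.
Qed.

Lemma eigenvalue_quad A a : eigenvalue A a ->
  exists2 x, x != 0 & quad A x = a * quad 1%:M x.
Proof.
case/eigenvalueP => x xA x0; exists x => //.
by rewrite /quad xA -scalemxAl mulmx1 mxE.
Qed.

(* The supremum m of the Rayleigh quotients is an eigenvalue: otherwise m - A
   would be coercive, and m would not be the least upper bound. *)
Lemma quad_le_largest_eigenvalue A x : A^T = A ->
  quad A x <= largest_eigenvalue A * quad 1%:M x.
Proof.
move=> Asym; have [->|x_neq0] := eqVneq x 0.
  by rewrite /quad !mul0mx mxE mulr0.
pose S : set R :=
  [set quad A z / quad 1%:M z | z in [set z : 'rV[R]_n | z != 0]]%classic.
have Sx : S (quad A x / quad 1%:M x) by exists x.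
have [C C0 Cle] := quad_le A.
have supS : has_sup S.
  split; first by exists (quad A x / quad 1%:M x).
  by exists C => _ [z z0 <-]; rewrite ler_pdivrMr ?quad1_gt0.
pose m := sup S.
have mle z : quad A z <= m * quad 1%:M z.
  have [->|z0] := eqVneq z 0; first by rewrite /quad !mul0mx mxE mulr0.
  rewrite -ler_pdivrMr ?quad1_gt0 //; apply: ub_le_sup; first by case: supS.
  by exists z.
suff -> : largest_eigenvalue A = m by [].
apply: largest_eigenvalue_eq; last first.
  move=> a /eigenvalue_quad[z z0 za].
  by rewrite -(ler_pM2r (quad1_gt0 z0)) -za.
have [Bu|] := boolP (m%:M - A \in unitmx).
  have Bsym : (m%:M - A)^T = m%:M - A by rewrite raddfB /= tr_scalar_mx Asym.
  have Bpsd z : 0 <= quad (m%:M - A) z by rewrite quad_scalar_sub subr_ge0.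
  have [c c0 cle] := psd_unit_coercive Bsym Bu Bpsd.
  suff : m <= m - c by rewrite lerBrDr gerDl leNgt c0.
  apply: ge_sup; first by case: supS.
  move=> _ [z z0 <-]; rewrite ler_pdivrMr ?quad1_gt0 //.
  by have := cle z; rewrite quad_scalar_sub mulrBl lerBrDl -lerBrDr.
rewrite /eigenvalue /eigenspace kermx_eq0 row_free_unit.
by rewrite -opprB -scaleN1r unitmxZ // unitrN1.
Qed.

(** Multiplying the entrywise inequalities by the nonnegative [x 0 j] and summing bounds the
    Rayleigh quotient of [x] below by [a]. *)
Lemma largest_eigenvalue_ge A x a : A^T = A -> x != 0 ->
    (forall j, 0 <= x 0 j) -> (forall j, a * x 0 j <= (x *m A) 0 j) ->
  a <= largest_eigenvalue A.
Proof.
move=> Asym x_neq0 x_ge0 ax; rewrite -(ler_pM2r (quad1_gt0 x_neq0)).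
apply: le_trans (quad_le_largest_eigenvalue x Asym).
rewrite quad1E quadE mulr_sumr; apply: ler_sum => j _.
by rewrite expr2 mulrA ler_wpM2r.
Qed.

(** The terms [((x *m A) 0 j - a * x 0 j) * x 0 j] are nonnegative, and their sum is at most 0 when
    [a] is the largest eigenvalue. So each vanishes, and positivity of [x] cancels the second
    factor. *)
Lemma largest_eigenvalue_eq_test A x a : A^T = A ->
    (forall j, 0 < x 0 j) -> (forall j, a * x 0 j <= (x *m A) 0 j) ->
  largest_eigenvalue A = a -> x *m A = a *: x.
Proof.
move=> Asym x_gt0 ax mua; have := quad_le_largest_eigenvalue x Asym.
rewrite mua quad1E quadE -subr_le0 mulr_sumr -sumrB => le0.
have ge0 j : 0 <= (x *m A) 0 j * x 0 j - a * x 0 j ^+ 2.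
  by rewrite expr2 mulrA -mulrBl mulr_ge0 ?subr_ge0 // ltW.
have : \sum_j ((x *m A) 0 j * x 0 j - a * x 0 j ^+ 2) == 0.
  by rewrite eq_le le0 sumr_ge0.
rewrite psumr_eq0 // => /allP eq0; apply/rowP => j.
have := eq0 j (mem_index_enum j); rewrite expr2 mulrA -mulrBl mulf_eq0.
by rewrite subr_eq0 (gt_eqF (x_gt0 j)) orbF [RHS]mxE => /eqP.
Qed.

(** The constant row is an eigenvector for [t]. For any other eigenvector, the eigenvalue equation
    at an entry of largest absolute value bounds the eigenvalue by that column's sum. *)
Lemma largest_eigenvalue_column_sum A t : (0 < n)%N ->
    (forall i j, 0 <= A i j) -> (forall j, \sum_i A i j = t) ->
  largest_eigenvalue A = t.
Proof.
move=> n_gt0 A_ge0 A_sum; pose i0 := Ordinal n_gt0.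
apply: largest_eigenvalue_eq => [|a /eigenvalueP[x xA x_neq0]].
  apply/eigenvalueP; exists (const_mx 1).
    apply/rowP => j; rewrite !mxE -(A_sum j) mulr1.
    by apply: eq_bigr => i _; rewrite mxE mul1r.
  by apply/eqP => /rowP/(_ i0); rewrite !mxE => /eqP; rewrite oner_eq0.
have [j _ xj_max] := @arg_maxP _ _ _ i0 xpredT (fun i => `|x 0 i|) isT.
have xj_gt0 : 0 < `|x 0 j|.
  rewrite lt_neqAle normr_ge0 andbT eq_sym; apply: contra x_neq0 => /eqP xj0.
  apply/eqP/rowP => i; rewrite mxE; apply/eqP.
  by rewrite -normr_le0 -xj0; exact: xj_max.
rewrite -(ler_pM2r xj_gt0); apply: le_trans (ler_norm _) _.
have /rowP/(_ j) := xA; rewrite [RHS]mxE normrM normr_id -normrM => <-.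
rewrite mxE (le_trans (ler_norm_sum _ _ _)) // -(A_sum j) mulr_suml.
apply: ler_sum => i _; rewrite normrM mulrC (ger0_norm (A_ge0 i j)).
by rewrite ler_wpM2l //; exact: xj_max.
Qed.

End RayleighQuotient.

(** * Distances, transmissions and the two largest degrees *)

Section GraphDistance.
Variables (V : finType) (e : rel V).
Hypotheses (e_sym : symmetric e) (e_irr : irreflexive e).
Hypothesis e_conn : is_connected e.

(** A shortest walk from [u] to [v], reversed, is a walk from [v] to [u] of the same length. *)
Lemma dist_leC u v : (dist e v u <= dist e u v)%N.
Proof.
have [p [ep <- <-]] := dist_walk (e_conn u v).
have := @dist_min _ e (last u p) (rev (belast u p)).
rewrite rev_path (eq_path (e' := e)) => [/(_ ep)|x y]; last exact: e_sym.
rewrite size_rev size_belast; congr (dist e _ _ <= _)%N.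
by case: p {ep} => //= x p; rewrite rev_cons last_rcons.
Qed.

Lemma distC u v : dist e u v = dist e v u.
Proof. by apply/eqP; rewrite eqn_leq !dist_leC. Qed.

Lemma distxx u : dist e u u = 0%N.
Proof. by apply/eqP; rewrite -leqn0 (@dist_min _ e u [::]). Qed.

Lemma dist_gt0 u v : u != v -> (0 < dist e u v)%N.
Proof.
have [p [_ <- <-]] := dist_walk (e_conn u v).
by case: p => //=; rewrite eqxx.
Qed.

Lemma dist_eq1 u v : dist e u v = 1%N -> e u v.
Proof.
have [p [ep <- <-]] := dist_walk (e_conn u v).
by case: p ep => [|x [|y p]] //=; rewrite andbT.
Qed.

Lemma dist_adj u v : e u v -> dist e u v = 1%N.
Proof.
move=> euv; apply/eqP; rewrite eqn_leq dist_gt0; last first.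
  by apply/eqP => uv; rewrite uv e_irr in euv.
by rewrite (@dist_min _ e u [:: v]) //= euv.
Qed.

(** One summand of the transmission bound: the correction terms raise distances 0 and 1 to exactly
    2, and distinct nonadjacent vertices are already at distance at least 2. *)
Lemma dist_ge2 u v :
  (2 <= dist e u v + e u v + (u == v).*2 ?= iff (dist e u v <= 2))%N.
Proof.
have [->|uv] := eqVneq u v; first by rewrite distxx e_irr.
have := dist_gt0 uv; have [euv|euv] := boolP (e u v).
  by rewrite dist_adj.
rewrite addn0 addn0.
have : dist e u v != 1%N by apply: contra euv => /eqP/dist_eq1.
by case: (dist e u v) => [|[|d]] // _ _; split=> //; rewrite eqn_leq.
Qed.

(** Summing [dist_ge2] over [v] turns the adjacency terms into the degree and the diagonal term into
    2; equality holds iff it holds in every summand. *)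
Lemma transmission_ge u :
  (2 * #|V| <= transmission e u + degree e u + 2
    ?= iff [forall v, dist e u v <= 2])%N.
Proof.
have sum_diag : (\sum_v (u == v).*2 = 2)%N.
  rewrite (bigD1 u) //= eqxx big1 // => v /negPf.
  by rewrite eq_sym => ->.
have deg : degree e u = (\sum_v e u v)%N.
  rewrite /degree -sum1dep_card big_mkcond.
  by apply: eq_bigr => v _; case: (e u v).
have := leqif_sum (fun v (_ : xpredT v) => dist_ge2 u v).
by rewrite sum_nat_const mulnC !big_split /= sum_diag -deg.
Qed.

Lemma dist_le_transmission u v : (dist e u v <= transmission e u)%N.
Proof. by rewrite /transmission (bigD1 v) //= leq_addr. Qed.

Lemma diameter_le k : (diameter e <= k)%N <-> forall u v, (dist e u v <= k)%N.
Proof.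
split=> [/bigmax_leqP dk u v|dk].
  by have /bigmax_leqP := dk u isT; apply.
by apply/bigmax_leqP => u _; apply/bigmax_leqP => v _.
Qed.

Lemma degree_lt u : (degree e u < #|V|)%N.
Proof.
rewrite /degree -cardsT; apply: proper_card; rewrite properT.
by apply/eqP => /setP/(_ u); rewrite !inE e_irr.
Qed.

(** Sorting the vertices by degree, rather than the degrees, exhibits the first two entries of the
    degree sequence as degrees of distinct vertices. *)
Lemma max_degree_vertices : (2 <= #|V|)%N -> exists u w,
  [/\ u != w, max_degree e = degree e u, second_max_degree e = degree e w,
      (degree e w <= degree e u)%N &
      forall v, v != u -> (degree e v <= degree e w)%N].
Proof.
pose geq_deg := relpre (degree e) geq.
have geq_deg_trans : transitive geq_deg by move=> y x z /[swap]; apply: leq_trans.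
rewrite /max_degree /second_max_degree /degree_sequence sort_map cardE.
rewrite -(size_sort geq_deg); have := mem_sort geq_deg (enum V).
have := sort_uniq geq_deg (enum V); rewrite enum_uniq.
have : sorted geq_deg (sort geq_deg (enum V)).
  by apply: sort_sorted => x y; apply: leq_total.
case: (sort _ _) => [|u [|w s]] //= /andP[uw ws] /and3P[us _ _] sV _.
exists u, w; split=> //; first by move: us; rewrite inE negb_or => /andP[].
move=> v vu; have := sV v; rewrite mem_enum !inE (negPf vu) /=.
case/orP => [/eqP -> //|vs]; have := order_path_min geq_deg_trans ws.
by move=> /allP/(_ v vs).
Qed.

End GraphDistance.

(** * Action of the distance alpha-matrix on functions of the vertices *)

Section DistanceAlpha.
Variables (R : realType) (V : finType) (e : rel V) (alpha : R).
Hypotheses (e_sym : symmetric e) (e_irr : irreflexive e).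
Hypothesis e_conn : is_connected e.

Lemma distance_alpha_sym :
  (distance_alpha_matrix e alpha)^T = distance_alpha_matrix e alpha.
Proof.
rewrite /distance_alpha_matrix raddfD /= !linearZ /= tr_diag_mx.
congr (_ + _ *: _); apply/matrixP => i j; rewrite !mxE.
by rewrite (distC e_sym e_conn).
Qed.

Lemma distance_alpha_row (f : V -> R) j : let v := enum_val j in
  ((\row_i f (enum_val i)) *m distance_alpha_matrix e alpha) 0 j =
  alpha * (transmission e v)%:R * f v +
  (1 - alpha) * \sum_w (dist e v w)%:R * f w.
Proof.
move=> v; rewrite /distance_alpha_matrix mulmxDr -!scalemxAr.
rewrite /transmission_matrix mul_mx_diag !mxE -mulrA (mulrC (f _)).
congr (_ + _ * _); rewrite [RHS](reindex _ (onW_bij _ (enum_val_bij V))) /=.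
by apply: eq_bigr => i _; rewrite !mxE mulrC (distC e_sym e_conn).
Qed.

(** The function is the constant [x2] plus [x1 - x2] at [u]: the constant contributes the
    transmission, the correction a single distance. *)
Lemma distance_alpha_row_ite u (x1 x2 : R) j : let v := enum_val j in
  ((\row_i (if enum_val i == u then x1 else x2))
     *m distance_alpha_matrix e alpha) 0 j =
  alpha * (transmission e v)%:R * (if v == u then x1 else x2) +
  (1 - alpha) * ((transmission e v)%:R * x2 + (dist e v u)%:R * (x1 - x2)).
Proof.
move=> v.
rewrite (distance_alpha_row (fun w => if w == u then x1 else x2)) -/v.
congr (_ + _ * _); rewrite /transmission natr_sum mulr_suml.
rewrite (bigD1 u) //= eqxx [in RHS](bigD1 u) //=.
rewrite (eq_bigr (fun w => (dist e v w)%:R * x2)) => [|w /negPf -> //].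
by ring.
Qed.

Lemma spectral_radius_transmission_regular t : (0 < #|V|)%N ->
    0 <= alpha <= 1 -> (forall v, (transmission e v)%:R = t) ->
  distance_alpha_spectral_radius e alpha = t.
Proof.
move=> V_gt0 /andP[a0 a1] Tt; apply: largest_eigenvalue_column_sum => //.
  move=> i j; rewrite !mxE addr_ge0 // mulr_ge0 ?subr_ge0 //.
  by rewrite mulrn_wge0.
move=> j; have := distance_alpha_row (fun=> 1) j; rewrite mxE /=.
under eq_bigr do rewrite mxE mul1r; move=> ->.
under eq_bigr do rewrite mulr1; rewrite -natr_sum -/(transmission _ _).
by rewrite Tt; ring.
Qed.

End DistanceAlpha.

(** * The quadratic equation defining the bound *)

Section QuadraticBound.
Variables (R : realType) (alpha : R).

Definition two_transmission_bound (t1 t2 : R) : R :=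
  1 / 2 * (alpha * (t1 + t2) +
    Num.sqrt (alpha ^+ 2 * (t1 + t2) ^+ 2 - 4 * (2 * alpha - 1) * t1 * t2)).

Lemma two_transmission_boundxx t : 0 <= t -> alpha <= 1 ->
  two_transmission_bound t t = t.
Proof.
move=> t0 a1; rewrite /two_transmission_bound.
have -> : alpha ^+ 2 * (t + t) ^+ 2 - 4 * (2 * alpha - 1) * t * t =
  (2 * (1 - alpha) * t) ^+ 2 by ring.
rewrite sqrtr_sqr ger0_norm; first by field.
by rewrite !mulr_ge0 ?subr_ge0.
Qed.

Variables (t1 t2 : R).
Hypotheses (a_lt1 : alpha < 1) (t1_gt0 : 0 < t1) (t12 : t1 <= t2).
Let lam := two_transmission_bound t1 t2.

Lemma two_transmission_bound_root :
  (lam - alpha * t1) * (lam - alpha * t2) = (1 - alpha) ^+ 2 * t1 * t2.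
Proof.
have disc_ge0 :
    0 <= alpha ^+ 2 * (t1 + t2) ^+ 2 - 4 * (2 * alpha - 1) * t1 * t2.
  (* Written this way the discriminant is visibly nonnegative, so [Num.sqrt] is a genuine root and
     not its default 0. *)
  have -> : alpha ^+ 2 * (t1 + t2) ^+ 2 - 4 * (2 * alpha - 1) * t1 * t2 =
    (alpha * (t1 - t2)) ^+ 2 + (2 * (1 - alpha)) ^+ 2 * (t1 * t2) by ring.
  rewrite addr_ge0 ?sqr_ge0 // mulr_ge0 ?sqr_ge0 // mulr_ge0 ?ltW //.
  exact: lt_le_trans t12.
have := sqr_sqrtr disc_ge0; rewrite /lam /two_transmission_bound.
set s := Num.sqrt _ => s2.
apply/eqP; rewrite -subr_eq0; apply/eqP.
have -> : (1 / 2 * (alpha * (t1 + t2) + s) - alpha * t1) *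
  (1 / 2 * (alpha * (t1 + t2) + s) - alpha * t2) -
  (1 - alpha) ^+ 2 * t1 * t2 =
  (s ^+ 2 - (alpha ^+ 2 * (t1 + t2) ^+ 2 - 4 * (2 * alpha - 1) * t1 * t2)) / 4.
  by field.
by rewrite s2 subrr mul0r.
Qed.

(** Needed for [x1 <= x2] in the main argument, where [x2 - x1] equals [lam - t1]. *)
Lemma two_transmission_bound_ge : t1 <= lam.
Proof.
suff : 2 * t1 - alpha * (t1 + t2) <=
  Num.sqrt (alpha ^+ 2 * (t1 + t2) ^+ 2 - 4 * (2 * alpha - 1) * t1 * t2).
  by rewrite /lam /two_transmission_bound; lra.
(* The left side may be negative, so its absolute value, as the root of its square, is compared with
   the root of the discriminant. *)
apply: le_trans (ler_norm _) _; rewrite -sqrtr_sqr ler_wsqrtr // -subr_ge0.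
have -> : alpha ^+ 2 * (t1 + t2) ^+ 2 - 4 * (2 * alpha - 1) * t1 * t2 -
  (2 * t1 - alpha * (t1 + t2)) ^+ 2 =
  4 * (1 - alpha) * t1 * (t2 - t1) by ring.
by rewrite !mulr_ge0 ?subr_ge0 // ltW.
Qed.

End QuadraticBound.

(** * The two-valued test vector and the equality case *)

Theorem theorem3p2 (R : realType) (alpha : R) (V : finType) (e : rel V)
    (alpha_ge0 : 0 <= alpha) (alpha_lt1 : alpha < 1)
    (e_sym : symmetric e) (e_irr : irreflexive e) (e_conn : is_connected e)
    (order_ge2 : (2 <= #|V|)%N) :
  let n : R := #|V|%:R in
  let Delta : R := (max_degree e)%:R in
  let Delta' : R := (second_max_degree e)%:R in
  let mu : R := distance_alpha_spectral_radius e alpha in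
  let bound : R :=
    1 / 2 * (alpha * (4 * n - 4 - Delta - Delta') +
      Num.sqrt (alpha ^+ 2 * (4 * n - 4 - Delta - Delta') ^+ 2
        - 4 * (2 * alpha - 1) * (2 * n - 2 - Delta) * (2 * n - 2 - Delta'))) in
  mu >= bound /\ (mu = bound <-> regular e /\ (diameter e <= 2)%N).
Proof.
move=> n Delta Delta' mu bound.
have V_gt0 : (0 < #|V|)%N by apply: ltnW.
have [u [w [uw DE D'E wu_deg w_deg]]] := max_degree_vertices e order_ge2.
pose t1 : R := 2 * n - 2 - Delta; pose t2 : R := 2 * n - 2 - Delta'.
have boundE : bound = two_transmission_bound alpha t1 t2.
  rewrite /bound; have -> : 4 * n - 4 - Delta - Delta' = t1 + t2.
    by rewrite /t1 /t2; ring.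
  by [].
pose T v : R := (transmission e v)%:R.
have T_ge v : 2 * n - 2 - (degree e v)%:R <= T v.
  have := (transmission_ge e_irr e_conn v).1.
  by rewrite -(ler_nat R) natrM !natrD /T /n; lra.
have T_eq v : T v = 2 * n - 2 - (degree e v)%:R <->
    forall z, (dist e v z <= 2)%N.
  have [_ eqT] := transmission_ge e_irr e_conn v; split=> [TE z|dist2].
    suff /forallP : [forall z, dist e v z <= 2]%N by apply.
    rewrite -eqT -(eqr_nat R) natrM !natrD -/(T v) TE /n; apply/eqP; ring.
  have /eqP/(congr1 (fun k => k%:R : R)) :
      (2 * #|V| == transmission e v + degree e v + 2)%N.
    by rewrite eqT; apply/forallP.
  by rewrite natrM !natrD /T /n; lra.
have t1_gt0 : 0 < t1.
  have := degree_lt e_irr u; rewrite -DE -(ler_nat R) -natr1 -/Delta -/n.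
  by move: order_ge2; rewrite -(ler_nat R) -/n /t1; lra.
have t12 : t1 <= t2.
  by move: wu_deg; rewrite -DE -D'E -(ler_nat R) -/Delta -/Delta' /t1 /t2; lra.
have Tu : t1 <= T u by rewrite /t1 /Delta DE.
have T_other v : v != u -> t2 <= T v.
  move=> /w_deg; rewrite -D'E -(ler_nat R) -/Delta' => vD.
  by have := T_ge v; rewrite /t2; lra.
set lam := two_transmission_bound alpha t1 t2 in boundE.
have lam_root : (lam - alpha * t1) * (lam - alpha * t2) =
    (1 - alpha) ^+ 2 * t1 * t2 by apply: two_transmission_bound_root.
have lam_ge : t1 <= lam by apply: two_transmission_bound_ge.
(* This eigenvector is read off the first row of the two-by-two matrix: [lam1] is then an identity,
   and [lam2] is the equation [lam_root]. *)
pose x1 := (1 - alpha) * t1; pose x2 := lam - alpha * t1.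
have x1_gt0 : 0 < x1 by rewrite mulr_gt0 // subr_gt0.
have x12 : x1 <= x2 by rewrite /x1 /x2; lra.
have x2_gt0 := lt_le_trans x1_gt0 x12.
have lam1 : lam * x1 = t1 * (alpha * x1 + (1 - alpha) * x2).
  by rewrite /x1 /x2; ring.
have lam2 : lam * x2 = t2 * (alpha * x2 + (1 - alpha) * x1).
  by rewrite /x1 /x2 in lam_root *; lra.
pose A := distance_alpha_matrix e alpha.
pose x : 'rV[R]_#|V| := \row_i (if enum_val i == u then x1 else x2).
(* The excess over [lam * x], after substituting [lam1] or [lam2], is a sum of products of factors
   that are all nonnegative. *)
have xA j : (x *m A) 0 j - lam * x 0 j =
    let v := enum_val j in
    if v == u then (T u - t1) * (alpha * x1 + (1 - alpha) * x2)
    else (T v - t2) * (alpha * x2 + (1 - alpha) * x1) +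
      (1 - alpha) * (T v - (dist e v u)%:R) * (x2 - x1).
  rewrite distance_alpha_row_ite // mxE /=; case: eqVneq => [->|_].
    by rewrite lam1 distxx /T; ring.
  by rewrite lam2 /T; ring.
have dist_T v z : (dist e v z)%:R <= T v.
  by rewrite ler_nat dist_le_transmission.
have a1_gt0 : 0 < 1 - alpha by rewrite subr_gt0.
have y12_gt0 : 0 < alpha * x1 + (1 - alpha) * x2.
  by rewrite ltr_wpDl ?mulr_ge0 ?mulr_gt0 // ltW.
have y21_gt0 : 0 < alpha * x2 + (1 - alpha) * x1.
  by rewrite ltr_wpDl ?mulr_ge0 ?mulr_gt0 // ltW.
have x_gt0 j : 0 < x 0 j by rewrite mxE; case: ifP.
have lam_xA j : lam * x 0 j <= (x *m A) 0 j.
  rewrite -subr_ge0 xA /=; case: eqVneq => [_|vu].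
    by rewrite mulr_ge0 ?subr_ge0 // ltW.
  by rewrite addr_ge0 ?mulr_ge0 ?subr_ge0 ?T_other // ltW.
have A_sym : A^T = A by apply: distance_alpha_sym.
rewrite boundE; split.
  apply: largest_eigenvalue_ge lam_xA => //; last by move=> j; apply: ltW.
  apply: contraTneq (x_gt0 (Ordinal V_gt0)) => ->.
  by rewrite mxE ltxx.
split=> [mu_lam|[[k deg_k] /diameter_le diam2]]; last first.
  have Delta_k : Delta = k%:R by rewrite /Delta DE deg_k.
  have t21 : t2 = t1 by rewrite /t2 /t1 Delta_k /Delta' D'E deg_k.
  rewrite /lam t21 two_transmission_boundxx ?ltW //.
  apply: spectral_radius_transmission_regular => //.
    by rewrite alpha_ge0 ltW.
  by move=> v; rewrite -/(T v) (T_eq v).2 // deg_k /t1 Delta_k.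
have xA_eq := largest_eigenvalue_eq_test A_sym x_gt0 lam_xA mu_lam.
have row_eq v : 0 = if v == u then (T u - t1) * (alpha * x1 + (1 - alpha) * x2)
    else (T v - t2) * (alpha * x2 + (1 - alpha) * x1) +
      (1 - alpha) * (T v - (dist e v u)%:R) * (x2 - x1).
  have := xA (enum_rank v); rewrite /= enum_rankK => <-.
  by rewrite xA_eq mxE subrr.
have Tu_eq : T u = t1.
  have /esym/eqP := row_eq u; rewrite eqxx mulf_eq0 (gt_eqF y12_gt0) orbF.
  by rewrite subr_eq0 => /eqP.
(* If [t1 < t2], the last summand of [row_eq w] would be positive: [T w] is at least [t2], hence
   exceeds [T u], which bounds the distance from [w] to [u]; and [x1 = x2] would make [lam1] and
   [lam2] force [t2 = t1]. *)
have t21 : t2 = t1.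
  apply/eqP; rewrite eq_le t12 andbT leNgt; apply/negP => t1_lt.
  have := row_eq w; rewrite eq_sym (negPf uw).
  have Tw : t2 <= T w by apply: T_other; rewrite eq_sym.
  have dist_lt : (dist e w u)%:R < T w.
    by rewrite (distC e_sym e_conn); have := dist_T u w; lra.
  have x12_lt : x1 < x2.
    rewrite lt_neqAle x12 andbT; apply: contraTneq t1_lt => x12E.
    have t21x : t2 * x1 = t1 * x1 by move: lam1 lam2; rewrite -x12E; lra.
    by rewrite -leNgt -(ler_pM2r x1_gt0) t21x.
  apply/eqP; rewrite lt_eqF // ltr_wpDl //.
    by rewrite mulr_ge0 ?subr_ge0 // ltW.
  by rewrite !mulr_gt0 ?subr_gt0.
have lam_t1 : lam = t1 by rewrite /lam t21 two_transmission_boundxx ?ltW.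
have x21 : x2 = x1 by rewrite /x2 /x1 lam_t1; ring.
have T_t1 v : T v = t1.
  have [->//|/negPf vu] := eqVneq v u.
  have := row_eq v; rewrite vu {2}x21 subrr mulr0 addr0 t21 => /esym/eqP.
  by rewrite mulf_eq0 (gt_eqF y21_gt0) orbF subr_eq0 => /eqP.
(* With [T v = t1], the transmission bound reads [Delta <= degree e v]; then [T_eq] holds with
   equality at every vertex and bounds the diameter. *)
have degE v : degree e v = max_degree e.
  apply/eqP; rewrite eqn_leq; apply/andP; split.
    have [->|/w_deg vw] := eqVneq v u; first by rewrite DE.
    by rewrite DE (leq_trans vw).
  by rewrite -(ler_nat R) -/Delta; have := T_ge v; rewrite T_t1 /t1; lra.
split; first by exists (max_degree e).
by apply/diameter_le => v; apply/T_eq; rewrite degE T_t1.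
Qed.
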